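(* Let $N\ge1$, $h,l>0$, $(\alpha,\beta)\in\mathbb R^2\setminus\{(0,0)\}$ and $\theta\in\mathbb R^3$ with $\theta_1\theta_2\theta_3\ne0$. For the $N$-resonator system described in the context, with vertex conditions of type I or of type II, the transmission probability $T(k)=T(k;\theta_1,\theta_2,\theta_3)$ is homogeneous of degree zero in $(\theta_1,\theta_2,\theta_3)$: for every $k>0$, $$T(k;\lambda\theta_1,\lambda\theta_2,\lambda\theta_3)=T(k;\theta_1,\theta_2,\theta_3)\quad\text{for all }\lambda\in\mathbb R\setminus\{0\}.$$
   Context: Model. The metric graph $G$ has vertices $v_1,\dots,v_N$ of degree 3, placed on the real line (the channel) at $x_j=(j-1)h$, and vertices $u_1,\dots,u_N$ of degree 1. The channel consists of the leads $e_{in}=(-\infty,0]$ (ending at $v_1$), $e_{out}=[(N-1)h,+\infty)$ (starting at $v_N$), and the segments of length $h$ between consecutive $v_j$'s. At each $v_j$ a resonator edge $(v_j,u_j)$ of length $l$ is attached, with coordinate $s\in[0,l]$, $s=0$ at $v_j$ and $s=l$ at $u_j$. At $v=v_j$, $\psi_1(v),\psi_2(v),\psi_3(v)$ denote the limits of $\psi$ at $v$ along the left channel edge, the right channel edge and the resonator edge, and $\psi_i'(v)$ the corresponding one-sided derivatives taken in the direction from $v$ into the edge. Vertex conditions at every $v_j$. Type I: $\frac{\psi_1(v)}{\theta_1}=\frac{\psi_2(v)}{\theta_2}=\frac{\psi_3(v)}{\theta_3}$ and $\theta_1\psi_1'(v)+\theta_2\psi_2'(v)+\theta_3\psi_3'(v)=0$.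 Type II: $\frac{\psi_1'(v)}{\theta_1}=\frac{\psi_2'(v)}{\theta_2}=\frac{\psi_3'(v)}{\theta_3}$ and $\theta_1\psi_1(v)+\theta_2\psi_2(v)+\theta_3\psi_3(v)=0$. Endpoint condition at each $u_j$: $\alpha\psi+\beta\frac{d\psi}{ds}=0$ at $s=l$. Scattering solution at wavenumber $k>0$: a function $\psi$ on $G$ with $\psi''+k^2\psi=0$ on every edge, satisfying all vertex and endpoint conditions, with $\psi(x)=e^{ikx}+r(k)e^{-ikx}$ on $e_{in}$ and $\psi(x)=t(k)e^{ikx}$ on $e_{out}$. The amplitudes are uniquely determined; the transmission probability is $T(k)=|t(k)|^2$. All parameters other than those displayed in $T(k;\theta_1,\theta_2,\theta_3)$, and the type of vertex conditions, are kept fixed. *)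

(* Defs.v *)
From Stdlib Require Import Reals Lra Lia ClassicalEpsilon.
From Coquelicot Require Import Coquelicot.
Open Scope R_scope.

(** [expi x] is exp(i x) for real [x]. *)
Definition expi (x : R) : C := (cos x, sin x).

(** [psi'' + k^2 psi = 0] at every point of the open set [D]; [psi1] is the
    derivative of [psi]. *)
Definition helmholtz_on (k : R) (D : R -> Prop) (psi : R -> C) : Prop :=
  exists psi1 : R -> C, forall x : R, D x ->
    is_derive (K := R_AbsRing) (V := C_R_NormedModule) psi x (psi1 x) /\
    is_derive (K := R_AbsRing) (V := C_R_NormedModule) psi1 x
      (- (RtoC (k ^ 2) * psi x))%C.

(** Here [g s] is the value of a function on an edge at distance [s] from an
    endpoint of this edge: [a] is the limit at the endpoint along the edge, and
    [b] the one-sided derivative there, in the direction from the endpoint into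
    the edge.  The number [g 0] is irrelevant: a function on the graph need not
    have a common value on the edges meeting at a vertex. *)
Definition endpoint_data (g : R -> C) (a b : C) : Prop :=
  filterlim g (at_right 0) (@locally C_R_NormedModule a) /\
  filterlim (fun s : R => ((g s - a) / RtoC s)%C) (at_right 0)
    (@locally C_R_NormedModule b).

Inductive vertex_type : Set := typeI | typeII.

(** [ai] and [bi] stand for the limit and for the inward derivative along the
    i-th edge: left channel edge, right channel edge, resonator. *)
Definition vertex_condition (ty : vertex_type) (th1 th2 th3 : R)
    (a1 b1 a2 b2 a3 b3 : C) : Prop :=
  match ty with
  | typeI =>
      (a1 / RtoC th1 = a2 / RtoC th2 /\ a2 / RtoC th2 = a3 / RtoC th3 /\
       RtoC th1 * b1 + RtoC th2 * b2 + RtoC th3 * b3 = 0)%C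
  | typeII =>
      (b1 / RtoC th1 = b2 / RtoC th2 /\ b2 / RtoC th2 = b3 / RtoC th3 /\
       RtoC th1 * a1 + RtoC th2 * a2 + RtoC th3 * a3 = 0)%C
  end.

(** The vertices of degree 3 are numbered from 0, vertex [j < N] being at
    [INR j * h]. *)
Definition off_vertices (N : nat) (h x : R) : Prop :=
  forall j : nat, (j < N)%nat -> x <> INR j * h.

(** A function on the graph is given by its restriction [psi] to the channel and
    its restrictions [phi j] to the resonators, all considered on the open edges
    only. *)
Record is_scattering_solution (ty : vertex_type) (N : nat)
    (h l alpha beta th1 th2 th3 k : R) (r t : C)
    (psi : R -> C) (phi : nat -> R -> C) : Prop := {
  channel_eq : helmholtz_on k (off_vertices N h) psi;
  resonator_eq : forall j : nat, (j < N)%nat ->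
    helmholtz_on k (fun s => 0 < s < l) (phi j);
  vertex_eq : forall j : nat, (j < N)%nat ->
    exists a1 b1 a2 b2 a3 b3 : C,
      endpoint_data (fun s => psi (INR j * h - s)) a1 b1 /\
      endpoint_data (fun s => psi (INR j * h + s)) a2 b2 /\
      endpoint_data (phi j) a3 b3 /\
      vertex_condition ty th1 th2 th3 a1 b1 a2 b2 a3 b3;
  (* [b] is the derivative in the direction of decreasing [s], so that
     [dphi/ds = - b] at [s = l]. *)
  end_eq : forall j : nat, (j < N)%nat ->
    exists a b : C,
      endpoint_data (fun s => phi j (l - s)) a b /\
      (RtoC alpha * a + RtoC beta * - b = 0)%C;
  incoming_eq : forall x : R, x < 0 ->
    psi x = (expi (k * x) + r * expi (- (k * x)))%C;
  outgoing_eq : forall x : R, INR (N - 1) * h < x ->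
    psi x = (t * expi (k * x))%C
}.

(** The pairs (reflection amplitude, transmission amplitude). *)
Definition are_amplitudes (ty : vertex_type) (N : nat)
    (h l alpha beta th1 th2 th3 k : R) (rt : C * C) : Prop :=
  exists (psi : R -> C) (phi : nat -> R -> C),
    is_scattering_solution ty N h l alpha beta th1 th2 th3 k
      (fst rt) (snd rt) psi phi.

(** The choice is harmless: [amplitudes_exist_unique] below shows that there is
    exactly one pair of amplitudes. *)
Definition amplitudes (ty : vertex_type) (N : nat)
    (h l alpha beta th1 th2 th3 k : R) : C * C :=
  epsilon (inhabits (RtoC 0, RtoC 0))
    (are_amplitudes ty N h l alpha beta th1 th2 th3 k).

Definition transmission_probability (ty : vertex_type) (N : nat)
    (h l alpha beta k th1 th2 th3 : R) : R :=
  Cmod (snd (amplitudes ty N h l alpha beta th1 th2 th3 k)) ^ 2.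

Lemma C_eta_eq (z w : C) : fst z = fst w -> snd z = snd w -> z = w.
Proof. destruct z, w; simpl; congruence. Qed.

Lemma filterlim_C {F : (R -> Prop) -> Prop} {FF : Filter F} (f : R -> C) (z : C) :
  filterlim (fun x => fst (f x)) F (locally (fst z)) ->
  filterlim (fun x => snd (f x)) F (locally (snd z)) ->
  filterlim f F (@locally C_R_NormedModule z).
Proof.
  intros H1 H2. apply filterlim_locally. intros eps.
  apply (fun H => proj1 (filterlim_locally _ _) H eps) in H1.
  apply (fun H => proj1 (filterlim_locally _ _) H eps) in H2.
  generalize (filter_and _ _ H1 H2). apply filter_imp.
  intros x [A B]; split; assumption.
Qed.

Lemma is_derive_C (f : R -> C) (x : R) (z : C) :
  is_derive (K := R_AbsRing) (V := C_R_NormedModule) f x z <->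
  is_derive (fun x => fst (f x)) x (fst z) /\
  is_derive (fun x => snd (f x)) x (snd z).
Proof.
  split.
  - intros H; split.
    + apply (filterdiff_comp' (K := R_AbsRing) (U := AbsRing_NormedModule R_AbsRing)
        (V := C_R_NormedModule) (W := AbsRing_NormedModule R_AbsRing)
        f (fun w : C => fst w) x (fun y => scal y z) (fun w : C => fst w) H).
      apply filterdiff_linear.
      exact (is_linear_fst (K := R_AbsRing) (U := R_NormedModule) (V := R_NormedModule)).
    + apply (filterdiff_comp' (K := R_AbsRing) (U := AbsRing_NormedModule R_AbsRing)
        (V := C_R_NormedModule) (W := AbsRing_NormedModule R_AbsRing)
        f (fun w : C => snd w) x (fun y => scal y z) (fun w : C => snd w) H).
      apply filterdiff_linear.
      exact (is_linear_snd (K := R_AbsRing) (U := R_NormedModule) (V := R_NormedModule)).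
  - intros [H1 H2].
    assert (E : is_derive (K := R_AbsRing) (V := C_R_NormedModule) (fun x => (fst (f x), snd (f x)) : C) x z).
    { assert (L : filterdiff (K := R_AbsRing) (U := AbsRing_NormedModule R_AbsRing)
        (V := C_R_NormedModule) (fun x => (fst (f x), snd (f x)) : C) (locally x)
        (fun y : R => (scal (K := R_AbsRing) (V := AbsRing_NormedModule R_AbsRing) y (fst z),
           scal (K := R_AbsRing) (V := AbsRing_NormedModule R_AbsRing) y (snd z)) : C)).
      { apply (filterdiff_comp'_2 (K := R_AbsRing) (T := AbsRing_NormedModule R_AbsRing)
         (U := AbsRing_NormedModule R_AbsRing) (V := AbsRing_NormedModule R_AbsRing)
         (W := C_R_NormedModule) (fun x => fst (f x)) (fun x => snd (f x))
         (fun a b => (a, b) : C) x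
         (fun y => scal y (fst z)) (fun y => scal y (snd z))
         (fun a b => (a, b) : C) H1 H2).
        apply filterdiff_linear. split.
        - intros [] []; reflexivity.
        - intros a []; reflexivity.
        - exists 1; split; [lra|]. intros [u v]. rewrite Rmult_1_l. apply Rle_refl. }
      exact L. }
    revert E; apply is_derive_ext. intros t; destruct (f t); reflexivity.
Qed.

Definition wave (k : R) (A B : C) (x : R) : C :=
  (A * RtoC (cos (k * x)) + B * RtoC (sin (k * x)))%C.

Definition wave1 (k : R) (A B : C) (x : R) : C :=
  (RtoC k * (B * RtoC (cos (k * x)) - A * RtoC (sin (k * x))))%C.

Ltac C_parts := apply C_eta_eq; simpl; try ring.

Lemma fst_wave k A B x :
  fst (wave k A B x) = fst A * cos (k * x) + fst B * sin (k * x).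
Proof. simpl; ring. Qed.
Lemma snd_wave k A B x :
  snd (wave k A B x) = snd A * cos (k * x) + snd B * sin (k * x).
Proof. simpl; ring. Qed.
Lemma fst_wave1 k A B x :
  fst (wave1 k A B x) = k * (fst B * cos (k * x) - fst A * sin (k * x)).
Proof. simpl; ring. Qed.
Lemma snd_wave1 k A B x :
  snd (wave1 k A B x) = k * (snd B * cos (k * x) - snd A * sin (k * x)).
Proof. simpl; ring. Qed.

Lemma is_derive_wave k A B x :
  is_derive (K := R_AbsRing) (V := C_R_NormedModule)
    (wave k A B) x (wave1 k A B x).
Proof.
  apply is_derive_C; split.
  - apply (is_derive_ext (fun x => fst A * cos (k * x) + fst B * sin (k * x))).
    { intros t; symmetry; apply fst_wave. }
    rewrite fst_wave1. auto_derive; [easy|ring].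
  - apply (is_derive_ext (fun x => snd A * cos (k * x) + snd B * sin (k * x))).
    { intros t; symmetry; apply snd_wave. }
    rewrite snd_wave1. auto_derive; [easy|ring].
Qed.

Lemma is_derive_wave1 k A B x :
  is_derive (K := R_AbsRing) (V := C_R_NormedModule)
    (wave1 k A B) x (- (RtoC (k ^ 2) * wave k A B x))%C.
Proof.
  apply is_derive_C; split.
  - apply (is_derive_ext
      (fun x => k * (fst B * cos (k * x) - fst A * sin (k * x)))).
    { intros t; symmetry; apply fst_wave1. }
    simpl. auto_derive; [easy|ring].
  - apply (is_derive_ext
      (fun x => k * (snd B * cos (k * x) - snd A * sin (k * x)))).
    { intros t; symmetry; apply snd_wave1. }
    simpl. auto_derive; [easy|ring].
Qed.

Lemma is_derive_zero_const (u : R -> R) (a b : R) :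
  (forall x, a < x < b -> is_derive u x 0) ->
  forall x y, a < x < b -> a < y < b -> u x = u y.
Proof.
  assert (W : forall x y, x < y -> (forall z, x <= z <= y -> is_derive u z 0) ->
    u x = u y).
  { intros x y xy H. apply (eq_is_derive (V := R_NormedModule)); assumption. }
  intros H x y Hx Hy.
  destruct (Rtotal_order x y) as [xy | [-> | xy]]; [|reflexivity|symmetry];
  apply W; try assumption; intros z Hz; apply H; lra.
Qed.

Lemma real_waves (k a b : R) (u u1 : R -> R) : 0 < k -> a < b ->
  (forall x, a < x < b -> is_derive u x (u1 x) /\
     is_derive u1 x (- (k ^ 2 * u x))) ->
  exists A B, forall x, a < x < b -> u x = A * cos (k * x) + B * sin (k * x).
Proof.
  intros Hk Hab H.
  set (P x := u x * cos (k * x) - u1 x / k * sin (k * x)).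
  set (Q x := u x * sin (k * x) + u1 x / k * cos (k * x)).
  set (m := (a + b) / 2).
  exists (P m), (Q m). intros x Hx.
  assert (Hm : a < m < b) by (unfold m; lra).
  rewrite (is_derive_zero_const P a b) with (x := m) (y := x); trivial.
  rewrite (is_derive_zero_const Q a b) with (x := m) (y := x); trivial.
  - unfold P, Q. generalize (sin2_cos2 (k * x)); unfold Rsqr; intros E.
    replace (u x) with (u x * 1) at 1 by ring. rewrite <- E. ring.
  - intros y Hy. destruct (H y Hy) as [D1 D2]. unfold Q.
    auto_derive.
    { repeat split; eexists; eassumption. }
    change (Derive (fun x => u x) y) with (Derive u y).
    change (Derive (fun x => u1 x) y) with (Derive u1 y).
    rewrite (is_derive_unique _ _ _ D1), (is_derive_unique _ _ _ D2).
    field; lra.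
  - intros y Hy. destruct (H y Hy) as [D1 D2]. unfold P.
    auto_derive.
    { repeat split; eexists; eassumption. }
    change (Derive (fun x => u x) y) with (Derive u y).
    change (Derive (fun x => u1 x) y) with (Derive u1 y).
    rewrite (is_derive_unique _ _ _ D1), (is_derive_unique _ _ _ D2).
    field; lra.
Qed.

Lemma helmholtz_wave (k a b : R) (f : R -> C) : 0 < k -> a < b ->
  helmholtz_on k (fun x => a < x < b) f ->
  exists A B, forall x, a < x < b -> f x = wave k A B x.
Proof.
  intros Hk Hab [f1 H].
  destruct (real_waves k a b (fun x => fst (f x)) (fun x => fst (f1 x)) Hk Hab)
    as [A1 [B1 H1]].
  { intros x Hx. destruct (H x Hx) as [D1 D2].
    apply is_derive_C in D1. apply is_derive_C in D2.
    split; [apply D1|].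
    replace (- (k ^ 2 * fst (f x))) with (fst (- (RtoC (k ^ 2) * f x))%C)
      by (simpl; ring). apply D2. }
  destruct (real_waves k a b (fun x => snd (f x)) (fun x => snd (f1 x)) Hk Hab)
    as [A2 [B2 H2]].
  { intros x Hx. destruct (H x Hx) as [D1 D2].
    apply is_derive_C in D1. apply is_derive_C in D2.
    split; [apply D1|].
    replace (- (k ^ 2 * snd (f x))) with (snd (- (RtoC (k ^ 2) * f x))%C)
      by (simpl; ring). apply D2. }
  exists (A1, A2), (B1, B2). intros x Hx. apply C_eta_eq.
  - rewrite fst_wave. apply H1, Hx.
  - rewrite snd_wave. apply H2, Hx.
Qed.

Lemma limit_of_derive (u : R -> R) (l : R) : is_derive u 0 l ->
  filterlim u (at_right 0) (locally (u 0)) /\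
  filterlim (fun s => (u s - u 0) / s) (at_right 0) (locally l).
Proof.
  intros D; split.
  - eapply filterlim_filter_le_1.
    2: { apply (ex_derive_continuous (K := R_AbsRing) (V := R_NormedModule)).
         exists l; exact D. }
    apply filter_le_within.
  - apply filterlim_locally. intros eps.
    apply is_derive_Reals in D. destruct (D eps (cond_pos eps)) as [d Hd].
    exists d. intros s Hs Hs0.
    change (Rabs (s - 0) < d) in Hs. rewrite Rminus_0_r in Hs.
    specialize (Hd s (Rgt_not_eq _ _ Hs0) Hs). rewrite Rplus_0_l in Hd.
    exact Hd.
Qed.

Lemma endpoint_data_of_derive (f : R -> C) (z : C) :
  is_derive (K := R_AbsRing) (V := C_R_NormedModule) f 0 z ->
  endpoint_data f (f 0) z.
Proof.
  intros D. apply is_derive_C in D. destruct D as [D1 D2].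
  apply limit_of_derive in D1. apply limit_of_derive in D2.
  assert (Q : forall s, 0 < s ->
    ((fst (f s) - fst (f 0)) / s, (snd (f s) - snd (f 0)) / s)
    = ((f s - f 0) / RtoC s)%C).
  { intros s Hs. apply C_eta_eq; simpl; field; lra. }
  split.
  - apply filterlim_C; [apply D1|apply D2].
  - eapply filterlim_ext_loc.
    2: { apply (filterlim_C (fun s => ((fst (f s) - fst (f 0)) / s,
           (snd (f s) - snd (f 0)) / s) : C)); [apply D1|apply D2]. }
    exists (mkposreal 1 Rlt_0_1). intros s _ Hs. apply Q, Hs.
Qed.

Lemma endpoint_data_unique g a b a' b' :
  endpoint_data g a b -> endpoint_data g a' b' -> a = a' /\ b = b'.
Proof.
  intros [H1 H2] [H1' H2'].
  assert (E : a = a').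
  { exact (filterlim_locally_unique (V := C_R_NormedModule) g a a' H1 H1'). }
  split; [exact E|]. subst a'.
  exact (filterlim_locally_unique (V := C_R_NormedModule) _ b b' H2 H2').
Qed.

Lemma endpoint_data_ext f g a b d : 0 < d ->
  (forall s, 0 < s < d -> f s = g s) ->
  endpoint_data f a b -> endpoint_data g a b.
Proof.
  intros Hd E [H1 H2].
  assert (L : at_right 0 (fun s => f s = g s)).
  { exists (mkposreal d Hd). intros s Hs Hs0. apply E. split; [exact Hs0|].
    change (Rabs (s - 0) < d) in Hs. rewrite Rminus_0_r in Hs.
    apply Rabs_def2 in Hs. apply Hs. }
  split.
  - exact (filterlim_ext_loc _ _ L H1).
  - refine (filterlim_ext_loc _ _ _ H2).
    revert L. apply filter_imp. intros s ->. reflexivity.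
Qed.

Lemma endpoint_right k A B x0 :
  endpoint_data (fun s => wave k A B (x0 + s)) (wave k A B x0) (wave1 k A B x0).
Proof.
  assert (D := endpoint_data_of_derive (fun s => wave k A B (x0 + s))
    (wave1 k A B x0)).
  cbv beta in D. rewrite Rplus_0_r in D. apply D.
  replace (wave1 k A B x0) with
    (scal (K := R_AbsRing) (V := C_R_NormedModule) 1 (wave1 k A B (x0 + 0))).
  - apply (is_derive_comp (K := R_AbsRing) (V := C_R_NormedModule) (wave k A B)).
    + apply is_derive_wave.
    + auto_derive; [easy|ring].
  - rewrite Rplus_0_r. apply (scal_one (K := R_AbsRing) (V := C_R_NormedModule)).
Qed.

Lemma endpoint_left k A B x0 :
  endpoint_data (fun s => wave k A B (x0 - s)) (wave k A B x0)
    (- wave1 k A B x0)%C.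
Proof.
  assert (D := endpoint_data_of_derive (fun s => wave k A B (x0 - s))
    (- wave1 k A B x0)%C).
  cbv beta in D. rewrite Rminus_0_r in D. apply D.
  replace (- wave1 k A B x0)%C with
    (scal (K := R_AbsRing) (V := C_R_NormedModule) (-(1)) (wave1 k A B (x0 - 0))).
  - apply (is_derive_comp (K := R_AbsRing) (V := C_R_NormedModule) (wave k A B)).
    + apply is_derive_wave.
    + auto_derive; [easy|ring].
  - rewrite Rminus_0_r. exact (scal_opp_one (K := R_AbsRing) (V := C_R_NormedModule) _).
Qed.

Lemma C_choice {A B : Type} (P : A -> B -> Prop) :
  (forall a, exists b, P a b) -> exists f, forall a, P a (f a).
Proof.
  intros H. exists (fun a => proj1_sig (constructive_indefinite_description _ (H a))).
  intros a. apply proj2_sig.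
Qed.

(** The [j]-th edge of the channel. *)
Definition in_region (N : nat) (h : R) (j : nat) (x : R) : Prop :=
  (j = 0%nat \/ INR (j - 1) * h < x) /\ (j = N \/ x < INR j * h).

Lemma region_exists h : forall n x, off_vertices n h x ->
  exists j, (j <= n)%nat /\ in_region n h j x.
Proof.
  induction n as [|n IH]; intros x Hx.
  - exists 0%nat. split; [lia|]. split; left; reflexivity.
  - destruct (Rtotal_order x (INR n * h)) as [L | [E | G]].
    + destruct (IH x) as [j [Hj [H1 H2]]].
      { intros i Hi. apply Hx. lia. }
      exists j. split; [lia|]. split; [exact H1|].
      right. destruct H2 as [-> | H2]; assumption.
    + exfalso. apply (Hx n); [lia|exact E].
    + exists (S n). split; [lia|]. split; [right|left; reflexivity].
      replace (S n - 1)%nat with n by lia. exact G.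
Qed.

Lemma region_off_vertices N h j x : 0 < h -> (j <= N)%nat ->
  in_region N h j x -> off_vertices N h x.
Proof.
  intros Hh Hj [H1 H2] i Hi ->.
  destruct (Compare_dec.le_lt_dec j i) as [L | L].
  - destruct H2 as [-> | H2]; [lia|].
    apply le_INR in L. nra.
  - destruct H1 as [-> | H1]; [lia|].
    assert (L' : (i <= j - 1)%nat) by lia. apply le_INR in L'. nra.
Qed.

Lemma region_locally N h j x : in_region N h j x -> locally x (in_region N h j).
Proof.
  intros [H1 H2]. apply filter_and.
  - destruct H1 as [E | H1].
    + apply filter_forall. intros y; left; exact E.
    + generalize (open_gt _ _ H1). apply filter_imp. intros y Hy; right; exact Hy.
  - destruct H2 as [E | H2].
    + apply filter_forall. intros y; left; exact E.
    + generalize (open_lt _ _ H2). apply filter_imp. intros y Hy; right; exact Hy.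
Qed.

Lemma region_left N h j s : 0 < h -> (j < N)%nat -> 0 < s < h ->
  in_region N h j (INR j * h - s).
Proof.
  intros Hh Hj Hs. split.
  - destruct j as [|j]; [left; reflexivity|right].
    replace (S j - 1)%nat with j by lia. rewrite S_INR. lra.
  - right. lra.
Qed.

Lemma region_right N h j s : 0 < h -> (j < N)%nat -> 0 < s < h ->
  in_region N h (S j) (INR j * h + s).
Proof.
  intros Hh Hj Hs. split.
  - right. replace (S j - 1)%nat with j by lia. lra.
  - right. rewrite S_INR. lra.
Qed.

Fixpoint glue (h : R) (f : nat -> R -> C) (n : nat) (x : R) : C :=
  match n with
  | O => f O x
  | S m => if Rlt_dec x (INR m * h) then glue h f m x else f (S m) x
  end.

Lemma glue_region h f : 0 < h -> forall n j x, (j <= n)%nat ->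
  in_region n h j x -> glue h f n x = f j x.
Proof.
  intros Hh; induction n as [|n IH]; intros j x Hj [H1 H2].
  - replace j with 0%nat by lia. reflexivity.
  - simpl. destruct (Rlt_dec x (INR n * h)) as [L | L].
    + destruct (PeanoNat.Nat.eq_dec j (S n)) as [-> | Hjn].
      * exfalso. destruct H1 as [H1 | H1]; [discriminate|].
        replace (S n - 1)%nat with n in H1 by lia. lra.
      * apply IH; [lia|]. split; [exact H1|].
        destruct H2 as [H2 | H2]; [lia|]. right; exact H2.
    + destruct (PeanoNat.Nat.eq_dec j (S n)) as [-> | Hjn]; [reflexivity|].
      exfalso. destruct H2 as [H2 | H2]; [lia|].
      assert (Hj' : (j <= n)%nat) by lia. apply le_INR in Hj'. nra.
Qed.

Definition Wave (k : R) (u : C * C) := wave k (fst u) (snd u).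
Definition Wave1 (k : R) (u : C * C) := wave1 k (fst u) (snd u).

(** A solution, in terms of its coefficients [u j] on the [j]-th edge of the
    channel and [c j] on the [j]-th resonator. *)
Record normal_form (ty : vertex_type) (N : nat)
    (h l alpha beta th1 th2 th3 k : R) (u c : nat -> C * C) : Prop := {
  nf_vertex : forall j, (j < N)%nat ->
    vertex_condition ty th1 th2 th3
      (Wave k (u j) (INR j * h)) (- Wave1 k (u j) (INR j * h))%C
      (Wave k (u (S j)) (INR j * h)) (Wave1 k (u (S j)) (INR j * h))
      (Wave k (c j) 0) (Wave1 k (c j) 0);
  nf_end : forall j, (j < N)%nat ->
    (RtoC alpha * Wave k (c j) l + RtoC beta * Wave1 k (c j) l = 0)%C
}.

Lemma incoming_wave k r x :
  (expi (k * x) + r * expi (- (k * x)))%C =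
  Wave k ((1 + r)%C, (Ci * (1 - r))%C) x.
Proof.
  unfold expi, Wave, wave. rewrite cos_neg, sin_neg. C_parts.
Qed.

Lemma outgoing_wave k t x :
  (t * expi (k * x))%C = Wave k (t, (Ci * t)%C) x.
Proof. unfold expi, Wave, wave. C_parts. Qed.

Lemma solution_normal_form ty N h l alpha beta th1 th2 th3 k r t psi phi :
  (1 <= N)%nat -> 0 < h -> 0 < l -> 0 < k ->
  is_scattering_solution ty N h l alpha beta th1 th2 th3 k r t psi phi ->
  exists u c, normal_form ty N h l alpha beta th1 th2 th3 k u c /\
    u 0%nat = ((1 + r)%C, (Ci * (1 - r))%C) /\ u N = (t, (Ci * t)%C).
Proof.
  intros HN Hh Hl Hk [Hch Hres Hv He Hin Hout].
  destruct (C_choice (fun j v => (j <= N)%nat ->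
    (j = 0%nat -> v = ((1 + r)%C, (Ci * (1 - r))%C)) /\
    (j = N -> v = (t, (Ci * t)%C)) /\
    forall x, in_region N h j x -> psi x = Wave k v x)) as [u Hu].
  { intros j. destruct (PeanoNat.Nat.eq_dec j 0) as [-> | Hj0].
    { exists ((1 + r)%C, (Ci * (1 - r))%C). intros _.
      split; [reflexivity|]. split; [lia|].
      intros x [_ [H | H]]; [lia|]. rewrite <- incoming_wave. apply Hin.
      simpl in H. lra. }
    destruct (PeanoNat.Nat.eq_dec j N) as [-> | HjN].
    { exists (t, (Ci * t)%C). intros _.
      split; [lia|]. split; [reflexivity|].
      intros x [[H | H] _]; [lia|]. rewrite <- outgoing_wave. apply Hout, H. }
    destruct (Compare_dec.le_lt_dec N j) as [L | L].
    { exists (RtoC 0, RtoC 0). intros; lia. }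
    destruct (helmholtz_wave k (INR (j - 1) * h) (INR j * h) psi Hk) as [A [B H]].
    - assert (INR (j - 1) < INR j) by (apply lt_INR; lia). nra.
    - destruct Hch as [psi1 Hch]. exists psi1. intros x Hx. apply Hch.
      apply (region_off_vertices N h j); try assumption; try lia.
      split; right; apply Hx.
    - exists (A, B). intros _. split; [lia|]. split; [lia|].
      intros x [[H1 | H1] [H2 | H2]]; try lia. apply H. split; assumption. }
  destruct (C_choice (fun j v => (j < N)%nat ->
    forall s, 0 < s < l -> phi j s = Wave k v s)) as [c Hc].
  { intros j. destruct (Compare_dec.le_lt_dec N j) as [L | L].
    { exists (RtoC 0, RtoC 0). intros; lia. }
    destruct (helmholtz_wave k 0 l (phi j) Hk Hl (Hres j L)) as [A [B H]].
    exists (A, B). intros _. exact H. }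
  exists u, c. split; [split|split].
  - intros j Hj.
    destruct (Hv j Hj) as [a1 [b1 [a2 [b2 [a3 [b3 [E1 [E2 [E3 V]]]]]]]]].
    destruct (Hu j ltac:(lia)) as [_ [_ U1]].
    destruct (Hu (S j) ltac:(lia)) as [_ [_ U2]].
    assert (F1 := endpoint_data_ext _
      (fun s => Wave k (u j) (INR j * h - s)) _ _ h Hh
      (fun s Hs => U1 _ (region_left N h j s Hh Hj Hs)) E1).
    assert (F2 := endpoint_data_ext _
      (fun s => Wave k (u (S j)) (INR j * h + s)) _ _ h Hh
      (fun s Hs => U2 _ (region_right N h j s Hh Hj Hs)) E2).
    assert (F3 := endpoint_data_ext _ (fun s => Wave k (c j) (0 + s)) _ _ l Hl
      (fun s Hs => eq_trans (Hc j Hj s Hs)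
         (f_equal (Wave k (c j)) (eq_sym (Rplus_0_l s)))) E3).
    destruct (endpoint_data_unique _ _ _ _ _ F1 (endpoint_left _ _ _ _)) as [-> ->].
    destruct (endpoint_data_unique _ _ _ _ _ F2 (endpoint_right _ _ _ _)) as [-> ->].
    destruct (endpoint_data_unique _ _ _ _ _ F3 (endpoint_right _ _ _ _)) as [-> ->].
    exact V.
  - intros j Hj. destruct (He j Hj) as [a [b [E V]]].
    assert (F := endpoint_data_ext _ (fun s => Wave k (c j) (l - s)) _ _ l Hl
      (fun s Hs => Hc j Hj (l - s) ltac:(lra)) E).
    destruct (endpoint_data_unique _ _ _ _ _ F (endpoint_left _ _ _ _)) as [-> ->].
    rewrite <- V. unfold Wave, Wave1. ring.
  - apply (Hu 0%nat); [lia|reflexivity].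
  - apply (Hu N); [lia|reflexivity].
Qed.

Lemma normal_form_solution ty N h l alpha beta th1 th2 th3 k r t u c :
  (1 <= N)%nat -> 0 < h -> 0 < l -> 0 < k ->
  normal_form ty N h l alpha beta th1 th2 th3 k u c ->
  u 0%nat = ((1 + r)%C, (Ci * (1 - r))%C) -> u N = (t, (Ci * t)%C) ->
  is_scattering_solution ty N h l alpha beta th1 th2 th3 k r t
    (glue h (fun j => Wave k (u j)) N) (fun j => Wave k (c j)).
Proof.
  intros HN Hh Hl Hk [Hv He] H0 HtN. split.
  - exists (glue h (fun j => Wave1 k (u j)) N). intros x Hx.
    destruct (region_exists h N x Hx) as [j [Hj Rj]].
    rewrite !(glue_region h _ Hh N j x Hj Rj).
    assert (L := region_locally N h j x Rj).
    split.
    + apply (is_derive_ext_loc (K := R_AbsRing) (V := C_R_NormedModule)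
        (Wave k (u j))); [|apply is_derive_wave].
      revert L. apply filter_imp. intros y Ry.
      symmetry. apply (glue_region h (fun j => Wave k (u j)) Hh N j y Hj Ry).
    + apply (is_derive_ext_loc (K := R_AbsRing) (V := C_R_NormedModule)
        (Wave1 k (u j))); [|apply is_derive_wave1].
      revert L. apply filter_imp. intros y Ry.
      symmetry. apply (glue_region h (fun j => Wave1 k (u j)) Hh N j y Hj Ry).
  - intros j Hj. exists (Wave1 k (c j)). intros s _.
    split; [apply is_derive_wave|apply is_derive_wave1].
  - intros j Hj. do 6 eexists. split; [|split; [|split]].
    4: { apply (Hv j Hj). }
    + eapply endpoint_data_ext; [exact Hh| |apply endpoint_left].
      intros s Hs. symmetry.
      apply (glue_region h (fun j => Wave k (u j)) Hh N j); [lia|].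
      apply region_left; assumption.
    + eapply endpoint_data_ext; [exact Hh| |apply endpoint_right].
      intros s Hs. symmetry.
      apply (glue_region h (fun j => Wave k (u j)) Hh N (S j)); [lia|].
      apply region_right; assumption.
    + eapply endpoint_data_ext; [exact Rlt_0_1| |apply endpoint_right].
      intros s Hs. cbv beta. rewrite Rplus_0_l. reflexivity.
  - intros j Hj. do 2 eexists. split; [apply endpoint_left|].
    rewrite <- (He j Hj). unfold Wave, Wave1. ring.
  - intros x Hx.
    rewrite (glue_region h _ Hh N 0 x); [|lia|].
    + rewrite H0. symmetry. apply incoming_wave.
    + split; [left; reflexivity|right; simpl; lra].
  - intros x Hx.
    rewrite (glue_region h _ Hh N N x); [|lia|].
    + rewrite HtN. symmetry. apply outgoing_wave.
    + split; [right; exact Hx|left; reflexivity].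
Qed.

(** The flux form of the vertex conditions. *)
Definition wr (a b a' b' : C) : C := (b * Cconj a' - a * Cconj b')%C.

Definition wrs (u v : C * C) : C := wr (fst u) (snd u) (fst v) (snd v).

Lemma Cconj_RtoC (x : R) : Cconj (RtoC x) = RtoC x.
Proof. unfold Cconj, RtoC; simpl. now rewrite Ropp_0. Qed.

Lemma RtoC_neq_0 (x : R) : x <> 0 -> RtoC x <> RtoC 0.
Proof. intros H E. apply H. apply RtoC_inj, E. Qed.

Lemma wr_wave k u v x :
  wr (Wave k u x) (Wave1 k u x) (Wave k v x) (Wave1 k v x) =
  (RtoC k * wrs u v)%C.
Proof.
  unfold wr, wrs, wr, Wave, Wave1, wave, wave1.
  rewrite ?Cmult_conj, ?Cplus_conj, ?Cminus_conj, ?Cmult_conj, ?Cconj_RtoC.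
  set (c := RtoC (cos (k * x))). set (s := RtoC (sin (k * x))).
  assert (E : (c * c + s * s = 1)%C).
  { unfold c, s. rewrite <- !RtoC_mult, <- RtoC_plus. f_equal.
    generalize (sin2_cos2 (k * x)); unfold Rsqr; lra. }
  transitivity (RtoC k * (snd u * Cconj (fst v) - fst u * Cconj (snd v))
    * (c * c + s * s))%C; [ring|rewrite E; ring].
Qed.

Lemma vertex_wr ty th1 th2 th3 a1 b1 a2 b2 a3 b3 a1' b1' a2' b2' a3' b3' :
  th1 <> 0 -> th2 <> 0 -> th3 <> 0 ->
  vertex_condition ty th1 th2 th3 a1 b1 a2 b2 a3 b3 ->
  vertex_condition ty th1 th2 th3 a1' b1' a2' b2' a3' b3' ->
  (wr a1 b1 a1' b1' + wr a2 b2 a2' b2' + wr a3 b3 a3' b3' = 0)%C.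
Proof.
  intros T1 T2 T3 V V'.
  apply RtoC_neq_0 in T1. apply RtoC_neq_0 in T2. apply RtoC_neq_0 in T3.
  assert (D : forall (th : R) (a m : C), RtoC th <> RtoC 0 ->
    (m = a / RtoC th -> a = RtoC th * m)%C).
  { intros th a m Hth ->. now field. }
  destruct ty; destruct V as [E1 [E2 E3]], V' as [E1' [E2' E3']];
    rewrite <- E1 in E2; rewrite <- E1' in E2'.
  - set (m := (a1 / RtoC th1)%C) in *. set (m' := (a1' / RtoC th1)%C) in *.
    rewrite (D th1 a1 m T1 eq_refl), (D th2 a2 m T2 E1), (D th3 a3 m T3 E2).
    rewrite (D th1 a1' m' T1 eq_refl), (D th2 a2' m' T2 E1'), (D th3 a3' m' T3 E2').
    apply (f_equal Cconj) in E3'. unfold wr.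
    rewrite ?Cplus_conj, ?Cmult_conj, ?Cconj_RtoC in *.
    transitivity (Cconj m' * (RtoC th1 * b1 + RtoC th2 * b2 + RtoC th3 * b3)
     - m * (RtoC th1 * Cconj b1' + RtoC th2 * Cconj b2' + RtoC th3 * Cconj b3'))%C;
     [ring|]. rewrite E3, E3'. ring.
  - set (m := (b1 / RtoC th1)%C) in *. set (m' := (b1' / RtoC th1)%C) in *.
    rewrite (D th1 b1 m T1 eq_refl), (D th2 b2 m T2 E1), (D th3 b3 m T3 E2).
    rewrite (D th1 b1' m' T1 eq_refl), (D th2 b2' m' T2 E1'), (D th3 b3' m' T3 E2').
    apply (f_equal Cconj) in E3'. unfold wr.
    rewrite ?Cplus_conj, ?Cmult_conj, ?Cconj_RtoC in *.
    transitivity (m * (RtoC th1 * Cconj a1' + RtoC th2 * Cconj a2' + RtoC th3 * Cconj a3')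
     - Cconj m' * (RtoC th1 * a1 + RtoC th2 * a2 + RtoC th3 * a3))%C;
     [ring|]. rewrite E3, E3'. ring.
Qed.

Lemma end_wr (alpha beta : R) a b a' b' : (alpha, beta) <> (0, 0) ->
  (RtoC alpha * a + RtoC beta * b = 0)%C ->
  (RtoC alpha * a' + RtoC beta * b' = 0)%C -> wr a b a' b' = 0%C.
Proof.
  intros Hab E E'. apply (f_equal Cconj) in E'.
  rewrite ?Cplus_conj, ?Cmult_conj, ?Cconj_RtoC in E'.
  assert (A : (RtoC alpha * wr a b a' b' = 0)%C).
  { unfold wr. transitivity (b * (RtoC alpha * Cconj a' + RtoC beta * Cconj b')
      - (RtoC alpha * a + RtoC beta * b) * Cconj b')%C; [ring|].
    rewrite E, E'. ring. }
  assert (B : (RtoC beta * wr a b a' b' = 0)%C).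
  { unfold wr. transitivity ((RtoC alpha * a + RtoC beta * b) * Cconj a'
      - a * (RtoC alpha * Cconj a' + RtoC beta * Cconj b'))%C; [ring|].
    rewrite E, E'. ring. }
  destruct (Req_dec alpha 0) as [-> | Ha].
  - destruct (Req_dec beta 0) as [-> | Hb]; [now destruct Hab|].
    apply RtoC_neq_0 in Hb.
    transitivity (/ RtoC beta * (RtoC beta * wr a b a' b'))%C; [now field|].
    rewrite B. ring.
  - apply RtoC_neq_0 in Ha.
    transitivity (/ RtoC alpha * (RtoC alpha * wr a b a' b'))%C; [now field|].
    rewrite A. ring.
Qed.

Lemma flux_conserved ty N h l alpha beta th1 th2 th3 k u c u' c' :
  0 < k -> (alpha, beta) <> (0, 0) ->
  th1 <> 0 -> th2 <> 0 -> th3 <> 0 ->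
  normal_form ty N h l alpha beta th1 th2 th3 k u c ->
  normal_form ty N h l alpha beta th1 th2 th3 k u' c' ->
  wrs (u 0%nat) (u' 0%nat) = wrs (u N) (u' N).
Proof.
  intros Hk Hab T1 T2 T3 [Hv He] [Hv' He'].
  assert (K := RtoC_neq_0 k (Rgt_not_eq _ _ Hk)).
  assert (S : forall j, (j < N)%nat -> wrs (u j) (u' j) = wrs (u (S j)) (u' (S j))).
  { intros j Hj.
    assert (F := vertex_wr _ _ _ _ _ _ _ _ _ _ _ _ _ _ _ _ T1 T2 T3
      (Hv j Hj) (Hv' j Hj)).
    assert (G := end_wr _ _ _ _ _ _ Hab (He j Hj) (He' j Hj)).
    rewrite wr_wave in G. rewrite !wr_wave, G in F.
    assert (M : forall a b a' b', wr a (- b) a' (- b') = (- wr a b a' b')%C).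
    { intros. unfold wr. rewrite Copp_conj. ring. }
    rewrite M, wr_wave in F.
    set (x := wrs (u j) (u' j)) in *. set (y := wrs (u (S j)) (u' (S j))) in *.
    transitivity (y - / RtoC k * (- (RtoC k * x) + RtoC k * y + RtoC 0))%C;
      [now field|]. rewrite F. ring. }
  assert (P : forall j, (j <= N)%nat -> wrs (u 0%nat) (u' 0%nat) = wrs (u j) (u' j)).
  { induction j as [|j IH]; intros Hj; [reflexivity|].
    rewrite IH by lia. apply S. lia. }
  apply P. lia.
Qed.

Lemma amplitudes_unique ty N h l alpha beta th1 th2 th3 k rt rt' :
  (1 <= N)%nat -> 0 < h -> 0 < l -> (alpha, beta) <> (0, 0) ->
  th1 <> 0 -> th2 <> 0 -> th3 <> 0 -> 0 < k ->
  are_amplitudes ty N h l alpha beta th1 th2 th3 k rt ->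
  are_amplitudes ty N h l alpha beta th1 th2 th3 k rt' -> rt = rt'.
Proof.
  intros HN Hh Hl Hab T1 T2 T3 Hk [psi [phi S]] [psi' [phi' S']].
  destruct rt as [r t], rt' as [r' t']; simpl in *.
  apply solution_normal_form in S; trivial.
  apply solution_normal_form in S'; trivial.
  destruct S as [u [c [F [U0 UN]]]], S' as [u' [c' [F' [U0' UN']]]].
  assert (G := fun u c u' c' => flux_conserved ty N h l alpha beta th1 th2 th3 k
    u c u' c' Hk Hab T1 T2 T3).
  assert (W : forall x y x' y' : C,
    wrs ((1 + x)%C, (Ci * (1 - x))%C) ((1 + x')%C, (Ci * (1 - x'))%C) =
    wrs (y, (Ci * y)%C) (y', (Ci * y')%C) ->
    (1 - x * Cconj x' - y * Cconj y' = 0)%C).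
  { intros x y x' y' E. unfold wrs, wr in E. simpl fst in E. simpl snd in E.
    assert (CI : Cconj Ci = (- Ci)%C) by (unfold Ci; C_parts).
    rewrite ?Cmult_conj, ?Cplus_conj, ?Cminus_conj, ?Cconj_RtoC, CI in E.
    assert (NI : (RtoC 2 * Ci)%C <> RtoC 0).
    { intros Z. apply (f_equal snd) in Z. simpl in Z. lra. }
    set (z := (1 - x * Cconj x' - y * Cconj y')%C).
    assert (Z : (RtoC 2 * Ci * z = 0)%C).
    { apply (f_equal (fun w => w - y * Ci * RtoC 2 * Cconj y')%C) in E.
      unfold z. etransitivity; [|etransitivity; [exact E|]]; ring. }
    destruct (Ceq_dec z 0) as [E0 | E0]; [exact E0|].
    destruct (Cmult_neq_0 _ _ NI E0 Z). }
  assert (P11 := G _ _ _ _ F F). assert (P12 := G _ _ _ _ F F').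
  assert (P21 := G _ _ _ _ F' F). assert (P22 := G _ _ _ _ F' F').
  rewrite ?U0, ?UN, ?U0', ?UN' in *.
  apply W in P11. apply W in P12. apply W in P21. apply W in P22.
  assert (Q : ((r - r') * Cconj (r - r') + (t - t') * Cconj (t - t') = 0)%C).
  { rewrite !Cminus_conj.
    transitivity (- (1 - r * Cconj r - t * Cconj t) + (1 - r * Cconj r' - t * Cconj t')
      + (1 - r' * Cconj r - t' * Cconj t) - (1 - r' * Cconj r' - t' * Cconj t'))%C;
      [ring|]. rewrite P11, P12, P21, P22. ring. }
  rewrite <- !Cmod2_conj, <- RtoC_plus in Q. apply RtoC_inj in Q.
  assert (Z : forall z w, Cmod z ^ 2 + Cmod w ^ 2 = 0 -> z = 0%C).
  { intros z w E. apply Cmod_eq_0. generalize (pow2_ge_0 (Cmod w)) (Cmod_ge_0 z).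
    nra. }
  assert (Zr := Z _ _ Q). rewrite Rplus_comm in Q. assert (Zt := Z _ _ Q).
  f_equal.
  - transitivity (r' + (r - r'))%C; [ring|]. rewrite Zr. ring.
  - transitivity (t' + (t - t'))%C; [ring|]. rewrite Zt. ring.
Qed.

Lemma wave_solve k a b x : 0 < k ->
  exists u, Wave k u x = a /\ Wave1 k u x = b.
Proof.
  intros Hk. assert (K := RtoC_neq_0 k (Rgt_not_eq _ _ Hk)).
  set (c := RtoC (cos (k * x))). set (s := RtoC (sin (k * x))).
  assert (E : (c * c + s * s = 1)%C).
  { unfold c, s. rewrite <- !RtoC_mult, <- RtoC_plus. f_equal.
    generalize (sin2_cos2 (k * x)); unfold Rsqr; lra. }
  exists ((a * c - b / RtoC k * s)%C, (a * s + b / RtoC k * c)%C).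
  unfold Wave, Wave1, wave, wave1; simpl fst; simpl snd; fold c; fold s. split.
  - transitivity (a * (c * c + s * s))%C; [ring|rewrite E; ring].
  - transitivity (b * (c * c + s * s))%C; [now field|rewrite E; ring].
Qed.

Definition scale (z : C) (u : C * C) : C * C := ((z * fst u)%C, (z * snd u)%C).

Lemma Wave_scale k z u x : Wave k (scale z u) x = (z * Wave k u x)%C.
Proof. unfold Wave, wave; simpl fst; simpl snd; ring. Qed.

Lemma Wave1_scale k z u x : Wave1 k (scale z u) x = (z * Wave1 k u x)%C.
Proof. unfold Wave1, wave1; simpl fst; simpl snd; ring. Qed.

Lemma vertex_scale ty th1 th2 th3 z a1 b1 a2 b2 a3 b3 :
  vertex_condition ty th1 th2 th3 a1 b1 a2 b2 a3 b3 ->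
  vertex_condition ty th1 th2 th3 (z * a1)%C (z * b1)%C (z * a2)%C (z * b2)%C
    (z * a3)%C (z * b3)%C.
Proof.
  destruct ty; intros [E1 [E2 E3]]; unfold vertex_condition, Cdiv in *;
  rewrite <- !Cmult_assoc, E1, E2; (split; [reflexivity|split; [reflexivity|]]).
  - transitivity (z * (RtoC th1 * b1 + RtoC th2 * b2 + RtoC th3 * b3))%C;
      [ring|rewrite E3; ring].
  - transitivity (z * (RtoC th1 * a1 + RtoC th2 * a2 + RtoC th3 * a3))%C;
      [ring|rewrite E3; ring].
Qed.

Lemma normal_form_scale ty N h l alpha beta th1 th2 th3 k u c z :
  normal_form ty N h l alpha beta th1 th2 th3 k u c ->
  normal_form ty N h l alpha beta th1 th2 th3 k
    (fun j => scale z (u j)) (fun j => scale z (c j)).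
Proof.
  intros [Hv He]. split; intros j Hj; rewrite ?Wave_scale, ?Wave1_scale.
  - replace (- (z * Wave1 k (u j) (INR j * h)))%C
      with (z * - Wave1 k (u j) (INR j * h))%C by ring.
    apply vertex_scale, Hv, Hj.
  - transitivity (z * (RtoC alpha * Wave k (c j) l + RtoC beta * Wave1 k (c j) l))%C;
      [ring|rewrite (He j Hj); ring].
Qed.

Lemma backward_chain {A : Type} (P : nat -> A -> A -> Prop) :
  (forall j y, exists x, P j x y) ->
  forall n y, exists u, u n = y /\ forall j, (j < n)%nat -> P j (u j) (u (S j)).
Proof.
  intros H; induction n as [|n IH]; intros y.
  - exists (fun _ => y). split; [reflexivity|lia].
  - destruct (H n y) as [x Hx]. destruct (IH x) as [u [U1 U2]].
    exists (fun j => if Compare_dec.le_lt_dec j n then u j else y). split.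
    + destruct (Compare_dec.le_lt_dec (S n) n); [lia|reflexivity].
    + intros j Hj.
      destruct (Compare_dec.le_lt_dec j n); [|lia].
      destruct (Compare_dec.le_lt_dec (S j) n).
      * apply U2. lia.
      * assert (j = n) by lia. subst j. rewrite U1. exact Hx.
Qed.

(** The solution on a resonator that satisfies the endpoint condition. *)
Lemma resonator_solution (alpha beta k l : R) : 0 < k -> (alpha, beta) <> (0, 0) ->
  exists p q : R, (p <> 0 \/ q <> 0) /\ exists u,
    Wave k u 0 = RtoC p /\ Wave1 k u 0 = RtoC q /\
    (RtoC alpha * Wave k u l + RtoC beta * Wave1 k u l = 0)%C.
Proof.
  intros Hk Hab. set (c := cos (k * l)). set (s := sin (k * l)).
  assert (E : c * c + s * s = 1).
  { unfold c, s. generalize (sin2_cos2 (k * l)); unfold Rsqr; lra. }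
  exists (k * beta * c + alpha * s), (k * (k * beta * s - alpha * c)). split.
  - destruct (Req_dec (k * beta * c + alpha * s) 0) as [P | P]; [right|left; exact P].
    intros Q. apply Hab.
    assert (Q' : k * beta * s - alpha * c = 0).
    { apply Rmult_integral in Q. lra. }
    assert (B : k * beta = 0).
    { replace (k * beta) with (k * beta * (c * c + s * s)) by (rewrite E; ring).
      transitivity ((k * beta * c + alpha * s) * c + (k * beta * s - alpha * c) * s);
        [ring|rewrite P, Q'; ring]. }
    assert (A : alpha = 0).
    { replace alpha with (alpha * (c * c + s * s)) by (rewrite E; ring).
      transitivity ((k * beta * c + alpha * s) * s - (k * beta * s - alpha * c) * c);
        [ring|rewrite P, Q'; ring]. }
    apply Rmult_integral in B. f_equal; lra.
  - exists (RtoC (k * beta * c + alpha * s), RtoC (k * beta * s - alpha * c)).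
    unfold Wave, Wave1, wave, wave1. rewrite Rmult_0_r, cos_0, sin_0.
    simpl fst; simpl snd; fold c; fold s.
    split; [|split]; [C_parts|C_parts|].
    rewrite <- ?RtoC_mult, <- ?RtoC_minus, <- ?RtoC_plus, <- ?RtoC_mult,
      <- ?RtoC_plus. f_equal.
    transitivity (alpha * (k * beta * (c * c + s * s))
      + beta * k * (- alpha * (c * c + s * s))); [ring|rewrite E; ring].
Qed.

Lemma normal_form_exists ty N h l alpha beta th1 th2 th3 k :
  (1 <= N)%nat -> (alpha, beta) <> (0, 0) ->
  th1 <> 0 -> th2 <> 0 -> th3 <> 0 -> 0 < k ->
  exists r t u c, normal_form ty N h l alpha beta th1 th2 th3 k u c /\
    u 0%nat = ((1 + r)%C, (Ci * (1 - r))%C) /\ u N = (t, (Ci * t)%C).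
Proof.
  intros HN Hab T1 T2 T3 Hk.
  destruct (resonator_solution alpha beta k l Hk Hab)
    as [p [q [Hpq [f [F0 [F1 Fl]]]]]].
  assert (K1 := RtoC_neq_0 _ T1). assert (K2 := RtoC_neq_0 _ T2).
  assert (K3 := RtoC_neq_0 _ T3).
  assert (Fscale : forall z,
    (RtoC alpha * Wave k (scale z f) l + RtoC beta * Wave1 k (scale z f) l = 0)%C).
  { intros z. rewrite Wave_scale, Wave1_scale.
    transitivity (z * (RtoC alpha * Wave k f l + RtoC beta * Wave1 k f l))%C;
      [ring|rewrite Fl; ring]. }
  destruct (Req_dec (match ty with typeI => p | typeII => q end) 0)
    as [Z | NZ].
  - (* total reflection at the first vertex *)
    assert (Z0 : forall (x : R), Wave k (RtoC 0, RtoC 0) x = 0%C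
      /\ Wave1 k (RtoC 0, RtoC 0) x = 0%C).
    { intros x. unfold Wave, Wave1, wave, wave1; simpl fst; simpl snd.
      split; ring. }
    set (r := match ty with typeI => (- (1))%C | typeII => RtoC 1 end).
    set (z := match ty with
      | typeI => (2 * RtoC th1 * RtoC k * Ci / (RtoC th3 * RtoC q))%C
      | typeII => (- (2 * RtoC th1 / (RtoC th3 * RtoC p)))%C end).
    exists r, (RtoC 0),
      (fun j => match j with O => ((1 + r)%C, (Ci * (1 - r))%C)
                | _ => (RtoC 0, RtoC 0) end),
      (fun j => match j with O => scale z f | _ => scale 0 f end).
    split; [split|split].
    + intros j Hj. destruct (Z0 (INR j * h)) as [-> ->].
      destruct j as [|j].
      * rewrite Wave_scale, Wave1_scale, F0, F1.
        unfold r, z, Wave, Wave1, wave, wave1; simpl fst; simpl snd.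
        replace (k * (INR 0 * h)) with 0 by (simpl; ring).
        rewrite cos_0, sin_0.
        destruct ty; rewrite Z.
        -- assert (Q := RtoC_neq_0 q ltac:(lra)).
           split; [|split]; now field.
        -- assert (Q := RtoC_neq_0 p ltac:(lra)).
           split; [|split]; now field.
      * destruct (Z0 (INR (S j) * h)) as [-> ->].
        rewrite Wave_scale, Wave1_scale.
        destruct ty; (split; [|split]); try ring; now field.
    + intros [|j] Hj; apply Fscale.
    + reflexivity.
    + destruct N; [lia|]. f_equal. ring.
  - assert (ST : forall (j : nat) (y : C * C), exists x, exists z,
      vertex_condition ty th1 th2 th3
        (Wave k x (INR j * h)) (- Wave1 k x (INR j * h))%C
        (Wave k y (INR j * h)) (Wave1 k y (INR j * h))
        (z * RtoC p)%C (z * RtoC q)%C).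
    { intros j y. set (a2 := Wave k y (INR j * h)). set (b2 := Wave1 k y (INR j * h)).
      apply RtoC_neq_0 in NZ. destruct ty.
      - set (m := (a2 / RtoC th2)%C). set (z := (RtoC th3 * m / RtoC p)%C).
        destruct (wave_solve k (RtoC th1 * m)
          ((RtoC th2 * b2 + RtoC th3 * (z * RtoC q)) / RtoC th1)%C (INR j * h) Hk)
          as [x [X0 X1]].
        exists x, z. rewrite X0, X1. unfold z, m.
        split; [|split]; field; repeat split; assumption.
      - set (m := (b2 / RtoC th2)%C). set (z := (RtoC th3 * m / RtoC q)%C).
        destruct (wave_solve k
          (- ((RtoC th2 * a2 + RtoC th3 * (z * RtoC p)) / RtoC th1))%C
          (- (RtoC th1 * m))%C (INR j * h) Hk) as [x [X0 X1]].
        exists x, z. rewrite X0, X1. unfold z, m.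
        split; [|split]; field; repeat split; assumption. }
    destruct (backward_chain _ ST N (RtoC 1, Ci)) as [u [UN U]].
    destruct (C_choice (fun j z => (j < N)%nat -> vertex_condition ty th1 th2 th3
        (Wave k (u j) (INR j * h)) (- Wave1 k (u j) (INR j * h))%C
        (Wave k (u (S j)) (INR j * h)) (Wave1 k (u (S j)) (INR j * h))
        (z * RtoC p)%C (z * RtoC q)%C)) as [z Hz].
    { intros j. destruct (Compare_dec.le_lt_dec N j) as [L | L].
      - exists (RtoC 0). intros; lia.
      - destruct (U j L) as [z Hz]. exists z. intros _; exact Hz. }
    assert (F : normal_form ty N h l alpha beta th1 th2 th3 k u
      (fun j => scale (z j) f)).
    { split; intros j Hj; [|apply Fscale].
      rewrite Wave_scale, Wave1_scale, F0, F1. apply Hz, Hj. }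
    assert (G := flux_conserved _ _ _ _ _ _ _ _ _ _ _ _ _ _ Hk Hab T1 T2 T3 F F).
    rewrite UN in G. destruct (u 0%nat) as [A B] eqn:U0.
    assert (NI : (RtoC 2 * Ci)%C <> RtoC 0).
    { intros Y. apply (f_equal snd) in Y. simpl in Y. lra. }
    assert (D : (B + Ci * A)%C <> RtoC 0).
    { intros Y. assert (EB : B = (- (Ci * A))%C).
      { transitivity (B + Ci * A - Ci * A)%C; [ring|rewrite Y; ring]. }
      subst B. unfold wrs, wr in G. simpl in G.
      apply (f_equal snd) in G. destruct A as [x y]. simpl in G. nra. }
    set (w := (2 * Ci / (B + Ci * A))%C).
    exists (w * A - 1)%C, w, (fun j => scale w (u j)),
      (fun j => scale w (scale (z j) f)).
    split; [|split].
    + apply normal_form_scale with (1 := F).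
    + rewrite U0. unfold scale; simpl fst; simpl snd. f_equal; [ring|].
      assert (CC : (Ci * Ci = - (1))%C) by C_parts.
      transitivity (w * (B + Ci * A) - Ci * (w * A))%C; [ring|].
      replace (w * (B + Ci * A))%C with (2 * Ci)%C by (unfold w; field; exact D).
      ring.
    + rewrite UN. unfold scale; simpl fst; simpl snd. f_equal; ring.
Qed.

Theorem amplitudes_exist_unique :
  forall (ty : vertex_type) (N : nat) (h l alpha beta th1 th2 th3 k : R),
    (1 <= N)%nat -> 0 < h -> 0 < l -> (alpha, beta) <> (0, 0) ->
    th1 * th2 * th3 <> 0 -> 0 < k ->
    exists! rt : C * C, are_amplitudes ty N h l alpha beta th1 th2 th3 k rt.
Proof.
  intros ty N h l alpha beta th1 th2 th3 k HN Hh Hl Hab Hth Hk.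
  assert (T1 : th1 <> 0) by (intros ->; apply Hth; ring).
  assert (T2 : th2 <> 0) by (intros ->; apply Hth; ring).
  assert (T3 : th3 <> 0) by (intros ->; apply Hth; ring).
  destruct (normal_form_exists ty N h l alpha beta th1 th2 th3 k HN Hab T1 T2 T3 Hk)
    as [r [t [u [c [F [U0 UN]]]]]].
  assert (Ex : are_amplitudes ty N h l alpha beta th1 th2 th3 k (r, t)).
  { do 2 eexists. apply (normal_form_solution ty N h l alpha beta th1 th2 th3 k r t u c);
    assumption. }
  exists (r, t). split; [exact Ex|].
  intros rt' Ex'. apply (amplitudes_unique ty N h l alpha beta th1 th2 th3 k); assumption.
Qed.

(* Main.v *)
Require Import Defs.
From Stdlib Require Import Reals ClassicalEpsilon.
From Coquelicot Require Import Coquelicot.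
Open Scope R_scope.

(** The parameters [th1], [th2], [th3] enter the scattering problem only through
    the vertex conditions.  These say that a triple of limits (or of inward
    derivatives) is proportional to [(th1, th2, th3)] and that the other triple
    is orthogonal to it, so they depend only on the line spanned by
    [(th1, th2, th3)] ([vertex_condition_homogeneous]).  Hence a scattering
    solution for the old parameters is one for the rescaled parameters, with the
    same amplitudes.  As the amplitudes are unique, not only [T] but the pair
    [(r, t)] itself is invariant ([amplitudes_homogeneous]). *)

Lemma vertex_condition_homogeneous ty lambda th1 th2 th3 a1 b1 a2 b2 a3 b3 :
  lambda <> 0 -> th1 <> 0 -> th2 <> 0 -> th3 <> 0 ->
  vertex_condition ty th1 th2 th3 a1 b1 a2 b2 a3 b3 ->
  vertex_condition ty (lambda * th1) (lambda * th2) (lambda * th3)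
    a1 b1 a2 b2 a3 b3.
Proof.
  intros L T1 T2 T3.
  apply RtoC_neq_0 in L, T1, T2, T3.
  assert (ratio : forall (z : C) (th : R), RtoC th <> 0 ->
    (z / RtoC (lambda * th) = z / RtoC th / RtoC lambda)%C).
  { intros z th T. rewrite RtoC_mult. field; split; assumption. }
  assert (orth : forall x1 x2 x3 : C,
    (RtoC th1 * x1 + RtoC th2 * x2 + RtoC th3 * x3 = 0)%C ->
    (RtoC (lambda * th1) * x1 + RtoC (lambda * th2) * x2
      + RtoC (lambda * th3) * x3 = 0)%C).
  { intros x1 x2 x3 E. rewrite !RtoC_mult.
    transitivity (RtoC lambda * (RtoC th1 * x1 + RtoC th2 * x2 + RtoC th3 * x3))%C;
      [ring | rewrite E; ring]. }
  destruct ty; intros [E1 [E2 E3]]; unfold vertex_condition;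
  rewrite !ratio, E1, E2 by assumption; auto.
Qed.

Lemma are_amplitudes_homogeneous ty N h l alpha beta lambda th1 th2 th3 k rt :
  lambda <> 0 -> th1 <> 0 -> th2 <> 0 -> th3 <> 0 ->
  are_amplitudes ty N h l alpha beta th1 th2 th3 k rt ->
  are_amplitudes ty N h l alpha beta
    (lambda * th1) (lambda * th2) (lambda * th3) k rt.
Proof.
  intros L T1 T2 T3 [psi [phi [Hchan Hres Hvert Hend Hin Hout]]].
  exists psi, phi; split; try assumption.
  intros j Hj.
  destruct (Hvert j Hj) as [a1 [b1 [a2 [b2 [a3 [b3 [D1 [D2 [D3 V]]]]]]]]].
  exists a1, b1, a2, b2, a3, b3; repeat (split; [assumption |]).
  apply vertex_condition_homogeneous; assumption.
Qed.

Lemma amplitudes_spec ty N h l alpha beta th1 th2 th3 k :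
  (1 <= N)%nat -> 0 < h -> 0 < l -> (alpha, beta) <> (0, 0) ->
  th1 * th2 * th3 <> 0 -> 0 < k ->
  are_amplitudes ty N h l alpha beta th1 th2 th3 k
    (amplitudes ty N h l alpha beta th1 th2 th3 k).
Proof.
  intros HN Hh Hl Hab Hth Hk. unfold amplitudes. apply epsilon_spec.
  destruct (amplitudes_exist_unique ty N h l alpha beta th1 th2 th3 k
    HN Hh Hl Hab Hth Hk) as [rt [Hrt _]].
  exists rt; exact Hrt.
Qed.

Lemma amplitudes_homogeneous ty N h l alpha beta lambda th1 th2 th3 k :
  (1 <= N)%nat -> 0 < h -> 0 < l -> (alpha, beta) <> (0, 0) ->
  th1 * th2 * th3 <> 0 -> 0 < k -> lambda <> 0 ->
  amplitudes ty N h l alpha beta (lambda * th1) (lambda * th2) (lambda * th3) k =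
  amplitudes ty N h l alpha beta th1 th2 th3 k.
Proof.
  intros HN Hh Hl Hab Hth Hk L.
  assert (T1 : th1 <> 0) by (intros ->; apply Hth; ring).
  assert (T2 : th2 <> 0) by (intros ->; apply Hth; ring).
  assert (T3 : th3 <> 0) by (intros ->; apply Hth; ring).
  apply (amplitudes_unique ty N h l alpha beta
    (lambda * th1) (lambda * th2) (lambda * th3) k);
    auto using Rmult_integral_contrapositive_currified.
  - apply amplitudes_spec;
      auto using Rmult_integral_contrapositive_currified.
  - apply are_amplitudes_homogeneous; auto using amplitudes_spec.
Qed.

Theorem mainTheorem8 :
  forall (ty : vertex_type) (N : nat) (h l alpha beta th1 th2 th3 : R),
    (1 <= N)%nat -> 0 < h -> 0 < l -> (alpha, beta) <> (0, 0) ->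
    th1 * th2 * th3 <> 0 ->
    forall k : R, 0 < k ->
    forall lambda : R, lambda <> 0 ->
      transmission_probability ty N h l alpha beta k
        (lambda * th1) (lambda * th2) (lambda * th3) =
      transmission_probability ty N h l alpha beta k th1 th2 th3.
Proof.
  intros ty N h l alpha beta th1 th2 th3 HN Hh Hl Hab Hth k Hk lambda L.
  unfold transmission_probability.
  rewrite amplitudes_homogeneous by assumption. reflexivity.
Qed.
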